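(* The axiom system $\mathsf{EK}$ is sound for the language $\mathcal{L}_{E,K}$ with respect to the class of evidence models satisfying condition (E1): every theorem of $\mathsf{EK}$ is true at every evidence scenario of every evidence model satisfying (E1).
   Context: $\mathcal{L}_{E,K}$ is the propositional language over a countable set $\textsc{prop}$ of primitive propositions generated by $\phi ::= p \mid \neg\phi \mid \phi\wedge\psi \mid E\phi \mid K\phi$. An evidence model is a tuple $\mathcal{M}=(X,\mathcal{E},I,v)$ where $X$ is a nonempty set of worlds, $\mathcal{E}$ is a nonempty set of evidence states, $I=\{I_e\}_{e\in\mathcal{E}}$ with each $I_e: X\to 2^X$, and $v:\textsc{prop}\to 2^X$. Let $U_e=\{x\in X : x\in I_e(x)\}$. An evidence scenario is a pair $(x,e)$ with $x\in U_e$. Condition (E1): for all $e\in\mathcal{E}$ and $x,y\in X$, if $y\in I_e(x)$ then $y\in I_e(y)$. Truth at evidence scenarios: $(x,e)\models p$ iff $x\in v(p)$; Boolean connectives as usual; $(x,e)\models E\phi$ iff $I_e(x)\subseteq [\![\phi]\!]^e$; $(x,e)\models K\phi$ iff $\bigcup_{y\in X} I_e(y)\subseteq [\![\phi]\!]^e$, where $[\![\phi]\!]^e=\{y\in U_e : (y,e)\models\phi\}$. The system $\mathsf{EK}$ consists of: all classical propositional tautologies and modus ponens; for $K$ the $\mathsf{S5}$ principles $K(\phi\to\psi)\to(K\phi\to K\psi)$, $K\phi\to\phi$, $K\phi\to KK\phi$, $\neg K\phi\to K\neg K\phi$ and necessitation (from $\vdash\phi$ infer $\vdash K\phi$); for $E$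 the $\mathsf{KT}$ principles $E(\phi\to\psi)\to(E\phi\to E\psi)$, $E\phi\to\phi$ and necessitation for $E$; and the interaction axiom $K\phi\to E\phi$. *)

(* Defs.v *)
From mathcomp Require Import all_boot.
From mathcomp Require Import boolp classical_sets.

Set Implicit Arguments.
Unset Strict Implicit.
Unset Printing Implicit Defensive.

Local Open Scope classical_set_scope.

Inductive form (prop : countType) : Type :=
| Atom of prop
| Neg of form prop
| And of form prop & form prop
| EBox of form prop
| KBox of form prop.

Definition Imp (prop : countType) (phi psi : form prop) : form prop :=
  Neg (And phi (Neg psi)).

(* The Boolean assignment is arbitrary on atoms and on formulas of the form
   E phi and K phi, so these are exactly the substitution instances in the
   bimodal language of the classical propositional tautologies. *)
Definition tautology (prop : countType) (phi : form prop) : Prop :=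
  forall w : form prop -> bool,
    (forall psi, w (Neg psi) = ~~ w psi) ->
    (forall psi chi, w (And psi chi) = w psi && w chi) ->
    w phi = true.

Inductive EK (prop : countType) : form prop -> Prop :=
| EK_taut phi : tautology phi -> EK phi
| EK_MP phi psi : EK (Imp phi psi) -> EK phi -> EK psi
| EK_K_dist phi psi :
    EK (Imp (KBox (Imp phi psi)) (Imp (KBox phi) (KBox psi)))
| EK_K_T phi : EK (Imp (KBox phi) phi)
| EK_K_4 phi : EK (Imp (KBox phi) (KBox (KBox phi)))
| EK_K_5 phi : EK (Imp (Neg (KBox phi)) (KBox (Neg (KBox phi))))
| EK_K_nec phi : EK phi -> EK (KBox phi)
| EK_E_dist phi psi :
    EK (Imp (EBox (Imp phi psi)) (Imp (EBox phi) (EBox psi)))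
| EK_E_T phi : EK (Imp (EBox phi) phi)
| EK_E_nec phi : EK phi -> EK (EBox phi)
| EK_KE phi : EK (Imp (KBox phi) (EBox phi)).

Record evidence_model (prop : countType) : Type := EvidenceModel {
  world : Type;
  evidence : Type;
  world_nonempty : inhabited world;
  evidence_nonempty : inhabited evidence;
  info : evidence -> world -> set world;
  valuation : prop -> set world
}.

Section Semantics.
Variables (prop : countType) (M : evidence_model prop).

Definition U (e : evidence M) : set (world M) := [set x | info e x x].

Definition scenario (x : world M) (e : evidence M) : Prop := U e x.

Definition E1 : Prop :=
  forall (e : evidence M) (x y : world M), info e x y -> info e y y.

(* Truth is defined at every pair (x, e), but only its values at evidence
   scenarios are meaningful; the modal clauses consult only scenarios. *)
Fixpoint truth (x : world M) (e : evidence M) (phi : form prop) : Prop :=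
  match phi with
  | Atom p => valuation p x
  | Neg psi => ~ truth x e psi
  | And psi chi => truth x e psi /\ truth x e chi
  | EBox psi => info e x `<=` [set y | U e y /\ truth y e psi]
  | KBox psi =>
      \bigcup_(y in [set: world M]) info e y
        `<=` [set y | U e y /\ truth y e psi]
  end.

Definition truth_set (e : evidence M) (phi : form prop) : set (world M) :=
  [set y | U e y /\ truth y e phi].

Lemma truth_EBox x e phi :
  truth x e (EBox phi) = (info e x `<=` truth_set e phi).
Proof. by []. Qed.

Lemma truth_KBox x e phi :
  truth x e (KBox phi) =
  (\bigcup_(y in [set: world M]) info e y `<=` truth_set e phi).
Proof. by []. Qed.

End Semantics.

(* Main.v *)
(* Under (E1) the worlds in the range of some [I_e(y)] are exactly those of
   [U_e], so at a scenario [(x, e)] the modality K quantifies over all scenarios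
   [(y, e)], hence is S5, and E quantifies over a subset of them containing [x]. *)
Require Import Defs.
From mathcomp Require Import all_boot.
From mathcomp Require Import boolp classical_sets.

Local Open Scope classical_set_scope.

Lemma truth_Imp (prop : countType) (M : evidence_model prop)
    (x : world M) (e : evidence M) (phi psi : form prop) :
  truth x e (Imp phi psi) <-> (truth x e phi -> truth x e psi).
Proof.
split=> /= [h hphi|h [hphi]]; last by apply; exact: h.
(* [Imp] abbreviates a negated conjunction, so recovering [psi] itself takes classical logic. *)
by apply: contrapT => hpsi; apply: h.
Qed.

(** Truth at a fixed pair, reflected into [bool], is one of the assignments that [tautology]
    quantifies over: it respects [Neg] and [And], and modal formulas act as atoms. *)
Lemma truth_tautology (prop : countType) (M : evidence_model prop)
    (x : world M) (e : evidence M) (phi : form prop) :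
  tautology phi -> truth x e phi.
Proof.
move=> taut; apply/asboolP.
apply: (taut (fun psi => `[< truth x e psi >])) => [psi|psi chi] /=.
- exact: asbool_neg.
- exact: asbool_and.
Qed.

Lemma bigcup_info (prop : countType) (M : evidence_model prop)
    (e : evidence M) :
  E1 M -> \bigcup_(y in [set: world M]) info e y = U e.
Proof.
move=> hE1; apply/seteqP; split=> [z [y _]|z hz]; first exact: hE1.
(* [U e z] unfolds to [info e z z], so [z] is its own index in the union. *)
by exists z.
Qed.

Lemma truth_KBox_E1 (prop : countType) (M : evidence_model prop)
    (x : world M) (e : evidence M) (phi : form prop) :
  E1 M ->
  truth x e (KBox phi) <-> (forall y, scenario y e -> truth y e phi).
Proof.
move=> hE1; rewrite truth_KBox (bigcup_info _ _ _ hE1).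
by split=> h y hy; [have [] := h y hy | split=> //; exact: h].
Qed.

(** (E1) supplies the [U e y] part of [truth_set], leaving the Kripke clause for the relation
    [info e]. *)
Lemma truth_EBox_E1 (prop : countType) (M : evidence_model prop)
    (x : world M) (e : evidence M) (phi : form prop) :
  E1 M ->
  truth x e (EBox phi) <-> (forall y, info e x y -> truth y e phi).
Proof.
move=> hE1; rewrite truth_EBox.
split=> h y hy; first by have [] := h y hy.
by split; [exact: hE1 hy | exact: h].
Qed.

Theorem theorem1 (prop : countType) (phi : form prop) :
  EK phi ->
  forall M : evidence_model prop, E1 M ->
  forall (x : world M) (e : evidence M), scenario x e -> truth x e phi.
Proof.
move=> hphi M hE1.
have KP x e psi := truth_KBox_E1 prop M x e psi hE1.
have EP x e psi := truth_EBox_E1 prop M x e psi hE1.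
have ImpP := truth_Imp prop M.
(* The scenario stays universally quantified in the induction, since necessitation uses the
   hypothesis at other worlds. *)
elim: hphi => {phi}
  [phi taut|phi psi _ IHimp _ IHphi|phi psi|phi|phi|phi|phi _ IH
  |phi psi|phi|phi _ IH|phi] x e hx.
- exact: (truth_tautology prop M x e phi taut).
- by move/ImpP: (IHimp x e hx); apply; exact: IHphi.
- apply/ImpP => /KP himp; apply/ImpP => /KP hphi; apply/KP => y hy.
  by move/ImpP: (himp y hy); apply; exact: hphi.
- by apply/ImpP => /KP; apply.
- by apply/ImpP => /KP hphi; apply/KP => y _; apply/KP.
- (* The truth value of [KBox phi] does not depend on the world. *)
  by apply/ImpP => nK; apply/KP => y _; exact: nK.
- by apply/KP => y; exact: IH.
- apply/ImpP => /EP himp; apply/ImpP => /EP hphi; apply/EP => y hy.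
  by move/ImpP: (himp y hy); apply; exact: hphi.
(* Being a scenario is reflexivity of [info e] at [x], which yields T. *)
- by apply/ImpP => /EP; apply.
(* By (E1), every [y] in [info e x] gives a scenario with the same [e]. *)
- by apply/EP => y hy; apply: IH; exact: hE1 hy.
- by apply/ImpP => /KP hphi; apply/EP => y hy; apply: hphi; exact: hE1 hy.
Qed.
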